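(* Let $b\ge 2$ be an integer and let $X$ be a Benford variable (base $b$). For $j\ge 2$ let $A_{[j]}$ be the $j$-th most significant $b$-ary digit of $X$. Then for every $a\in\{0,1,\ldots,b-1\}$, $$\Pr(A_{[j]}=a)=\log_b\left(\frac{\Gamma\left((a+1)b^{-1}+b^{j-1}\right)\Gamma\left(a b^{-1}+b^{j-2}\right)}{\Gamma\left((a+1)b^{-1}+b^{j-2}\right)\Gamma\left(a b^{-1}+b^{j-1}\right)}\right).$$
   Context: A Benford variable (base $b$) is a positive continuous random variable $X$ such that the fractional part $\{\log_b X\}$ is uniformly distributed on $(0,1)$, where $\{z\}=z-\lfloor z\rfloor$. The $j$-th integer significand of $X$ is $A_{(j)}=\lfloor b^{\{\log_b X\}+j-1}\rfloor\in\{b^{j-1},\ldots,b^j-1\}$, and the $j$-th most significant $b$-ary digit is $A_{[j]}=A_{(j)}\bmod b$. $\Gamma$ is the gamma function. *)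

(* Defs.v *)
From mathcomp Require Import all_boot all_order all_algebra.
From mathcomp Require Import all_classical all_reals all_analysis.

Set Implicit Arguments.
Unset Strict Implicit.
Unset Printing Implicit Defensive.

Import Order.TTheory GRing.Theory Num.Theory.
Import numFieldNormedType.Exports.

Local Open Scope classical_set_scope.
Local Open Scope ring_scope.

Definition log_base (R : realType) (b : nat) (x : R) : R := ln x / ln b%:R.

Definition fracpart (R : realType) (z : R) : R := z - (Num.floor z)%:~R.

(* Euler's integral: this is the gamma function for 0 < x only (the integral
   diverges for x <= 0, where [Rintegral] is a junk value). *)
Definition Gamma (R : realType) (x : R) : R :=
  Rintegral (@lebesgue_measure R) `]0, +oo[ (fun t => t `^ (x - 1) * expR (- t)).

(* Positivity is required almost surely. "Continuous" means that the law is
   absolutely continuous with respect to Lebesgue measure. The last conjunct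
   equates laws on measurable sets only, since the values of measures on the
   other sets are irrelevant; [uniform_prob ltr01] is the uniform law on [0, 1],
   i.e. on (0, 1), the endpoints being negligible. *)
Definition Benford (R : realType) (d : measure_display) (T : measurableType d)
    (P : probability T R) (b : nat) (X : {RV P >-> R}) : Prop :=
  [/\ {ae P, forall w, 0 < X w},
      distribution P X `<< @lebesgue_measure R
    & forall U : set R, measurable U ->
        P [set w | U (fracpart (log_base b (X w)))] =
        uniform_prob (@ltr01 R) U].

Definition integer_significand (R : realType) (b j : nat) (x : R) : int :=
  Num.floor (b%:R `^ (fracpart (log_base b x) + j%:R - 1)).

Definition msdigit (R : realType) (b j : nat) (x : R) : int :=
  (integer_significand b j x %% b%:Z)%Z.

(* Main.v *)
Require Import Defs.
From mathcomp Require Import all_boot all_order all_algebra.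
From mathcomp Require Import all_classical all_reals all_analysis.
From mathcomp Require Import measurable_realfun ring lra zify.

Import Order.TTheory GRing.Theory Num.Theory.
Import numFieldNormedType.Exports.

Local Open Scope classical_set_scope.
Local Open Scope ring_scope.

(** Write u for the fractional part of log_b X, which is uniform, and shift the
    index so that the digit in question is the one of index j + 2. The integer
    significand floor (b^(u + j + 1)) equals m exactly when u lies between
    log_b m - (j + 1) and log_b (m + 1) - (j + 1)
    ([floor_powR_significand]), an event of probability log_b ((m + 1) / m).
    The digit is a exactly when m = k b + a for some k in [b^j, b^(j+1))
    ([msdigitP]), and distinct m give disjoint intervals, so the probability
    is the finite sum over these k of
      log_b (k b + a + 1) - log_b (k b + a)
        = log_b (k + (a + 1) / b) - log_b (k + a / b).
    Each of the two sums is a shift of the gamma function: the recurrence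
    Gamma (x + 1) = x Gamma x turns the sum of ln (x + i) over i < n into
    ln (Gamma (x + n)) - ln (Gamma x) ([ln_Gamma_add_nat]), here with
    x = a / b + b^j or (a + 1) / b + b^j, and n = b^(j+1) - b^j.

    All the arguments of Gamma are at least 1, where the integrand
    t^(x-1) e^(-t) of Euler's integral is continuous up to t = 0. The
    recurrence ([Gamma_recurrence]) is integration by parts: t^x e^(-t) - x
    t^(x-1) e^(-t) is the derivative of - t^x e^(-t), which vanishes at both
    ends of the half-line. *)

(** * The gamma function on [1, +oo[ *)

Section GammaFunction.
Context {R : realType}.
Notation mu := (@lebesgue_measure R).

Definition gamma_kernel (c t : R) : R := t `^ c * expR (- t).

Lemma gamma_kernel_ge0 c t : 0 <= gamma_kernel c t.
Proof. by rewrite mulr_ge0 ?powR_ge0 ?expR_ge0. Qed.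

Lemma measurable_gamma_kernel c (D : set R) : measurable_fun D (gamma_kernel c).
Proof.
apply: measurable_funTS; apply: measurable_funM; first exact: measurable_powR.
by apply: measurableT_comp => //; exact: measurable_expR.
Qed.

Lemma gamma_kernel_cvg_right0 c : 0 <= c ->
  gamma_kernel c t @[t --> 0^'+] --> gamma_kernel c 0.
Proof.
rewrite le_eqVlt /gamma_kernel => /predU1P[<-|c0]; apply: cvgM; last 1 first.
- by apply: cvg_at_right_filter; apply: continuous_comp;
    [exact: opp_continuous|exact: continuous_expR].
- by under eq_fun do rewrite powRr0; rewrite powRr0; exact: cvg_cst.
- by apply: cvg_at_right_filter; apply: continuous_comp;
    [exact: opp_continuous|exact: continuous_expR].
- by rewrite powR0 ?gt_eqF//; exact: powR_cvg0.
Qed.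

Lemma is_derive_gamma_kernel (c t : R) : 0 < t ->
  is_derive t 1 (gamma_kernel c)
    (c * gamma_kernel (c - 1) t - gamma_kernel c t).
Proof.
move=> t0; have dp := is_derive1_powR c t0.
have de : is_derive t 1 (fun x : R => expR (- x)) (- expR (- t)).
  by apply: is_derive_eq; rewrite mulrN1.
have h : is_derive t 1 (gamma_kernel c) _ := is_deriveM dp de.
apply: (is_derive_eq h); rewrite /gamma_kernel /GRing.scale/=; ring.
Qed.

Lemma continuous_gamma_kernel (c t : R) : 0 < t ->
  {for t, continuous (gamma_kernel c)}.
Proof.
move=> t0; have [d _] := is_derive_gamma_kernel c t t0.
by apply: differentiable_continuous; exact/derivable1_diffP.
Qed.

(** Apply s <= e^s to s = t / (2 (c + 1)) and raise to the power c: the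
    exponent s c that results is at most t / 2, so half of the decay of e^(-t)
    is left over. The bound gives both integrability and the limit at infinity. *)
Lemma gamma_kernel_le (c : R) : 0 <= c ->
  exists K : R, forall t, 0 <= t -> gamma_kernel c t <= K * expR (- 2^-1 * t).
Proof.
move=> c0; pose d : R := 2 * (c + 1); exists (d `^ c) => t t0.
have d0 : 0 < d by rewrite /d; lra.
rewrite /gamma_kernel -{1}[t](mulVKf (lt0r_neq0 d0)) powRM ?(ltW d0)//; last first.
  by rewrite mulr_ge0// invr_ge0 ltW.
rewrite -mulrA ler_wpM2l ?powR_ge0//.
have le1 : (d^-1 * t) `^ c <= expR (d^-1 * t) `^ c.
  apply: ge0_ler_powR; rewrite ?nnegrE ?expR_ge0//.
    by rewrite mulr_ge0// invr_ge0 ltW.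
  by rewrite (le_trans _ (expR_ge1Dx _))// lerDr.
apply: (le_trans (ler_wpM2r (expR_ge0 _) le1)).
rewrite -expRM -expRD ler_expR.
suff : c * d^-1 <= 2^-1 by move=> h; nra.
by rewrite ler_pdivrMr// /d; lra.
Qed.

Lemma integrable_gamma_kernel c : 0 <= c ->
  mu.-integrable `]0, +oo[ (EFin \o gamma_kernel c).
Proof.
move=> c0; have [K hK] := gamma_kernel_le c c0.
have i2 : mu.-integrable `]0, +oo[ (EFin \o exponential_pdf (2^-1 : R)).
  apply: (integrableS measurableT) => //.
  by apply: integrable_exponential_pdf; rewrite invr_gt0.
apply: (le_integrable _ _ _ (integrableZl _ (2 * K) i2)) => //.
- by apply/measurable_EFinP; exact: measurable_gamma_kernel.
- move=> t /=; rewrite in_itv/= andbT => t0.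
  rewrite lee_fin ger0_norm ?gamma_kernel_ge0//.
  apply: (le_trans (hK t (ltW t0))).
  rewrite exponential_pdfE ?(ltW t0)// (le_trans _ (ler_norm _))//.
  suff -> : 2 * K * (2^-1 * expR (- 2^-1 * t)) = K * expR (- 2^-1 * t) by [].
  by field.
Qed.

Lemma gamma_kernel_cvgy c : 0 <= c -> gamma_kernel c t @[t --> +oo] --> 0.
Proof.
move=> c0; have [K hK] := gamma_kernel_le c c0.
apply: (@squeeze_cvgr _ _ _ _ (fun=> 0) (fun t => K * expR (- 2^-1 * t))).
- near=> t; rewrite gamma_kernel_ge0/=; apply: hK.
  by near: t; apply: nbhs_pinfty_ge; rewrite num_real.
- exact: cvg_cst.
- rewrite -(mulr0 K); apply: cvgMl_tmp.
  under eq_fun do rewrite mulNr.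
  apply: (@cvg_comp _ _ _ (fun t => 2^-1 * t) (fun t => expR (- t)) _
    (pinfty_nbhs R)); last exact: cvgr_expR.
  by apply: gt0_cvgMry; rewrite ?invr_gt0.
Unshelve. all: by end_near. Qed.

Lemma GammaE (x : R) : Gamma x =
  \int[mu]_(t in `]0, +oo[) gamma_kernel (x - 1) t.
Proof. by []. Qed.

(** The derivative of - t^x e^(-t), written as the difference of the integrands
    of Gamma (x + 1) and x Gamma x. *)
Definition gamma_defect (x t : R) :=
  gamma_kernel x t - x * gamma_kernel (x - 1) t.

(** The factored form shows the sign: nonnegative from t = x on. *)
Lemma gamma_defectE (x t : R) : 0 < t ->
  gamma_defect x t = (t - x) * gamma_kernel (x - 1) t.
Proof.
move=> t0; have -> : gamma_defect x t =
    (t `^ (x - 1 + 1) - x * t `^ (x - 1)) * expR (- t).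
  by rewrite /gamma_defect /gamma_kernel subrK mulrBl mulrA.
by rewrite powRD ?(lt0r_neq0 t0) ?implybT// powRr1 ?(ltW t0)// /gamma_kernel; ring.
Qed.

Lemma is_derive_gamma_defect (x t : R) : 0 < t ->
  is_derive t 1 (fun u => - gamma_kernel x u) (gamma_defect x t).
Proof.
move=> t0; have d := is_derive_gamma_kernel x t t0.
have h : is_derive t 1 (fun u => - gamma_kernel x u) _ := is_deriveN d.
by apply: (is_derive_eq h); rewrite /gamma_defect opprB.
Qed.

Lemma continuous_gamma_defect (x t : R) : 0 < t ->
  {for t, continuous (gamma_defect x)}.
Proof.
move=> t0; apply: cvgB; first exact: continuous_gamma_kernel.
by apply: cvgMl_tmp; exact: continuous_gamma_kernel.
Qed.

(** The boundary term at 0 vanishes because 0^x = 0 for x > 0. *)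
Lemma gamma_defect_left (x : R) : 1 <= x ->
  \int[mu]_(t in `[0, x]) gamma_defect x t = - gamma_kernel x x.
Proof.
move=> x1; have x0 : 0 < x by lra.
have cN (t : R) : 0 < t -> {for t, continuous (fun u => - gamma_kernel x u)}.
  by move=> t0; apply: cvgN; exact: continuous_gamma_kernel.
rewrite /Rintegral (@continuous_FTC2 _ _ (fun u => - gamma_kernel x u))//.
- by rewrite -EFinB/= /gamma_kernel powR0 ?gt_eqF// mul0r oppr0 subr0.
- apply/continuous_within_itvP => //; split.
  + by move=> t; rewrite in_itv/= => /andP[t0 _]; exact: continuous_gamma_defect.
  + apply: cvgB; first by apply: gamma_kernel_cvg_right0; lra.
    by apply: cvgMl_tmp; apply: gamma_kernel_cvg_right0; lra.
  + by apply: cvg_at_left_filter; exact: continuous_gamma_defect.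
- split.
  + move=> t; rewrite in_itv/= => /andP[t0 _].
    by have [] := is_derive_gamma_defect x t t0.
  + by apply: cvgN; apply: gamma_kernel_cvg_right0; lra.
  + by apply: cvg_at_left_filter; exact: cN.
- move=> t; rewrite in_itv/= => /andP[t0 _].
  by rewrite derive1E; have [_] := is_derive_gamma_defect x t t0.
Qed.

(** From t = x on the integrand is nonnegative, so monotone convergence extends
    the fundamental theorem to the half-line; this is why the cut is at t = x. *)
Lemma gamma_defect_right (x : R) : 1 <= x ->
  \int[mu]_(t in `[x, +oo[) gamma_defect x t = gamma_kernel x x.
Proof.
move=> x1; have x0 : 0 < x by lra.
rewrite (@Rintegral_ge0_continuous_FTC2y _ _ (fun u => - gamma_kernel x u) _ (- 0)).
- by rewrite oppr0 add0r opprK.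
- move=> t xt; rewrite gamma_defectE ?(lt_le_trans x0)//.
  by rewrite mulr_ge0 ?gamma_kernel_ge0// subr_ge0.
- apply/continuous_within_itvcyP; split.
  + move=> t; rewrite in_itv/= andbT => xt; apply: continuous_gamma_defect.
    exact: lt_trans xt.
  + by apply: cvg_at_right_filter; exact: continuous_gamma_defect.
- by apply: cvgN; apply: gamma_kernel_cvgy; lra.
- by move=> t xt; have [] := is_derive_gamma_defect x t (lt_trans x0 xt).
- by apply: cvg_at_right_filter; apply: cvgN; exact: continuous_gamma_kernel.
- move=> t; rewrite in_itv/= andbT => xt.
  by rewrite derive1E; have [_] := is_derive_gamma_defect x t (lt_trans x0 xt).
Qed.

(** The boundary terms of the two pieces, - x^x e^(-x) on ]0, x] and x^x e^(-x)
    on ]x, +oo[, cancel. *)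
Lemma Gamma_recurrence (x : R) : 1 <= x -> Gamma (x + 1) = x * Gamma x.
Proof.
move=> x1; have ge0x : 0 <= x by lra.
have ge0x1 : 0 <= x - 1 by lra.
have i1 := integrable_gamma_kernel x ge0x.
have i0 := integrable_gamma_kernel (x - 1) ge0x1.
have i0x : mu.-integrable `]0, +oo[
    (EFin \o (fun t => x * gamma_kernel (x - 1) t)).
  exact: (integrableZl _ x i0).
have id : mu.-integrable `]0, +oo[ (EFin \o gamma_defect x).
  exact: (integrableB _ i1 i0x).
apply/eqP; rewrite -subr_eq0 !GammaE addrK -RintegralZl// -RintegralB//.
rewrite -/(gamma_defect x).
have := @Rintegral_itvB _ (gamma_defect x) (BRight 0) (BInfty _ false) x id.
rewrite !bnd_simp => /(_ ge0x isT) /eqP; rewrite subr_eq.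
have id1 : mu.-integrable `]0, x] (EFin \o gamma_defect x).
  by apply: (integrableS _ _ _ id) => //; exact: subset_itvl.
have id2 : mu.-integrable `]x, +oo[ (EFin \o gamma_defect x).
  by apply: (integrableS _ _ _ id) => //; apply: subset_itvr; rewrite bnd_simp.
rewrite (Rintegral_itv_obnd_cbnd id1) (Rintegral_itv_obnd_cbnd id2).
by rewrite gamma_defect_left// gamma_defect_right// subrr.
Qed.

(** On [1, 2] the integrand is at least e^(-2). *)
Lemma Gamma_gt0 (x : R) : 1 <= x -> 0 < Gamma x.
Proof.
move=> x1; have ge0x1 : 0 <= x - 1 by lra.
have i0 := integrable_gamma_kernel (x - 1) ge0x1.
rewrite GammaE.
have sub : `[1, 2] `<=` (`]0, +oo[ : set R).
  by move=> t; rewrite /= !in_itv/= andbT => /andP[t1 _]; lra.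
apply: (@lt_le_trans _ _ (expR (- 2 : R))); first exact: expR_gt0.
rewrite -lee_fin fineK; last exact: integrable_fin_num.
apply: (@le_trans _ _ (\int[mu]_(t in `[1%R, 2%R])
  (gamma_kernel (x - 1) t)%:E)%E); last first.
  apply: ge0_subset_integral => //.
  - by apply/measurable_EFinP; exact: measurable_gamma_kernel.
  - by move=> t _; rewrite lee_fin gamma_kernel_ge0.
apply: (@le_trans _ _ (\int[mu]_(t in `[1%R, 2%R]) (expR (- 2))%:E)%E).
  rewrite integral_cst//= lebesgue_measure_itv/= lte_fin ltr1n -EFinB -EFinM lee_fin.
  lra.
apply: ge0_le_integral => //.
- by apply/measurable_EFinP; exact: measurable_gamma_kernel.
- move=> t /=; rewrite in_itv/= => /andP[t1 t2]; rewrite lee_fin /gamma_kernel.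
  rewrite -[leLHS]mul1r; apply: ler_pM => //; rewrite ?expR_ge0//.
    by rewrite -[leLHS](powRr0 t); exact: ler_powR.
  by rewrite ler_expR lerN2.
Qed.
End GammaFunction.

Lemma ln_Gamma_add_nat (R : realType) (x : R) (n : nat) : 1 <= x ->
  ln (Gamma (x + n%:R)) = ln (Gamma x) + \sum_(i < n) ln (x + i%:R).
Proof.
move=> x1; elim: n => [|n IHn]; first by rewrite addr0 big_ord0 addr0.
have xn1 : 1 <= x + n%:R by rewrite (le_trans x1)// lerDl.
rewrite big_ord_recr/= addrA -IHn -natr1 addrA Gamma_recurrence//.
by rewrite lnM ?posrE ?Gamma_gt0 ?(lt_le_trans _ xn1)// [LHS]addrC.
Qed.

(** * Significands and digits as events on the fractional part *)

Section Significand.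
Context {R : realType}.
Implicit Types (b j m a : nat) (u x : R).

Lemma natr_ln_gt0 b : (2 <= b)%N -> 0 < ln (b%:R : R).
Proof. by move=> hb; rewrite ln_gt0// ltr1n. Qed.

Lemma fracpart_itv (z : R) : 0 <= fracpart z < 1.
Proof.
have := floor_itv z; rewrite /fracpart intrD => /andP[h1 h2].
by apply/andP; split; lra.
Qed.

Lemma uniform_prob_itv (l r : R) : 0 <= l -> l <= r -> r <= 1 ->
  uniform_prob (@ltr01 R) `[l, r[ = (r - l)%:E.
Proof.
move=> l0 lr r1; rewrite /uniform_prob.
rewrite (eq_integral (fun=> 1%:E)); last first.
  move=> x; rewrite inE/= in_itv/= => /andP[lx xr].
  by rewrite /uniform_pdf ifT ?subr0 ?invr1//; apply/andP; split; lra.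
rewrite integral_cst//= lebesgue_measure_itv/= mul1e lte_fin.
case: ltP => [_|rl]; first by rewrite EFinB.
by rewrite (_ : r - l = 0)//; apply/eqP; rewrite subr_eq0 eq_le rl lr.
Qed.

(** The fractional parts u with floor (b^(u + j - 1)) = m. *)
Definition significand_itv b j m : set R :=
  `[log_base b (m%:R : R) - j%:R + 1, log_base b (m.+1%:R : R) - j%:R + 1[.

Lemma floor_powR_significand b j m u : (2 <= b)%N -> (0 < m)%N ->
  (Num.floor (b%:R `^ (u + j%:R - 1)) = m%:Z) <-> significand_itv b j m u.
Proof.
move=> hb hm; have lb := natr_ln_gt0 b hb.
have b0 : 0 < b%:R :> R by rewrite ltr0n; lia.
have m0 : 0 < m%:R :> R by rewrite ltr0n.
have m1 : 0 < m.+1%:R :> R by rewrite ltr0n.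
have p0 : 0 < b%:R `^ (u + j%:R - 1) :> R by rewrite powR_gt0.
rewrite /significand_itv /= in_itv/= /log_base.
have -> : (Num.floor (b%:R `^ (u + j%:R - 1)) = m%:Z) <->
    ((m%:R : R) <= b%:R `^ (u + j%:R - 1) < m.+1%:R).
  by split=> [/eqP|h]; [|apply/eqP]; rewrite floor_eq -[(m%:Z + 1)]/((m + 1)%N%:Z) addn1.
rewrite -ler_ln ?posrE// -ltr_ln ?posrE// ln_powR.
rewrite -ler_pdivrMr// -ltr_pdivlMr//.
by split => /andP[h1 h2]; apply/andP; split; lra.
Qed.

(** The floor of b^(u + j - 1) is determined by u. *)
Lemma trivIset_significand_itv b j (D : set nat) (f : nat -> nat) :
  (2 <= b)%N -> (forall i, 0 < f i)%N -> injective f ->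
  trivIset D (fun i => significand_itv b j (f i)).
Proof.
move=> hb f0 finj; apply/trivIsetP => i k _ _ ik; apply/seteqP; split=> // u [].
move=> /(floor_powR_significand _ _ _ _ hb (f0 i)) +
  /(floor_powR_significand _ _ _ _ hb (f0 k)).
by move=> -> [] /finj /eqP; rewrite (negbTE ik).
Qed.

Lemma significand_bounds b j u : (2 <= b)%N -> 0 <= u < 1 ->
  exists2 s : nat, Num.floor (b%:R `^ (u + j.+1%:R - 1)) = s%:Z &
    (b ^ j <= s < b ^ j.+1)%N.
Proof.
move=> hb /andP[u0 u1].
have b1 : 1 < b%:R :> R by rewrite ltr1n.
have b0 : 0 < b%:R :> R by rewrite ltr0n; lia.
set y := b%:R `^ _.
have y1 : (b ^ j)%:R <= y.
  by rewrite natrX -powR_mulrn ?(ltW b0)// ler_powR ?(ltW b1)// -natr1; lra.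
have y2 : y < (b ^ j.+1)%:R.
  rewrite natrX -powR_mulrn ?(ltW b0)// /y /powR gt_eqF// ltr_expR.
  by rewrite ltr_pM2r ?natr_ln_gt0// -natr1; lra.
have := floor_ge_int y (b ^ j)%N%:Z; have := floor_lt_int y (b ^ j.+1)%N%:Z.
rewrite y1 y2; case: (Num.floor y) => // s; rewrite lez_nat ltz_nat => h1 h2.
by exists s => //; rewrite h1 h2.
Qed.

Lemma msdigitP b j a x : (2 <= b)%N -> (a < b)%N ->
  msdigit b j.+2 x = a%:Z <->
  exists2 k, (b ^ j <= k < b ^ j.+1)%N &
    significand_itv b j.+2 (k * b + a) (fracpart (log_base b x)).
Proof.
move=> hb hab; rewrite /msdigit /integer_significand.
set u := fracpart _; have hu : 0 <= u < 1 := fracpart_itv _.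
split=> [|[k /andP[k1 k2] hk]].
- have [s hs /andP[s1 s2]] := significand_bounds b j.+1 u hb hu.
  rewrite hs modz_nat => -[sa]; exists (s %/ b)%N.
    rewrite leq_divRL ?ltn_divLR; [|lia|lia].
    by rewrite -!expnSr s1 s2.
  by rewrite -sa -divn_eq; apply/floor_powR_significand => //;
    move: s1; rewrite expnS; lia.
- have bj : (0 < b ^ j)%N by rewrite expn_gt0; lia.
  have s0 : (0 < k * b + a)%N by nia.
  rewrite (proj2 (floor_powR_significand b j.+2 _ u hb s0) hk).
  by rewrite modz_nat modnMDl modn_small.
Qed.

(** With the four gamma values of the digit law for x, y, z, t, each inner
    difference compares two values whose arguments differ by an integer. *)
Lemma log_base_cross_ratio b (x y z t : R) : 0 < x -> 0 < y -> 0 < z -> 0 < t ->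
  log_base b ((x * y) / (z * t)) = ((ln x - ln z) - (ln t - ln y)) / ln b%:R.
Proof.
move=> x0 y0 z0 t0; rewrite /log_base ln_div ?posrE ?mulr_gt0// !lnM ?posrE//.
by congr (_ / _); ring.
Qed.

End Significand.

(** * The law of a digit *)

Theorem mainTheorem5 (R : realType) (d : measure_display) (T : measurableType d)
    (P : probability T R) (b : nat) (hb : (2 <= b)%N)
    (X : {RV P >-> R}) (hX : Benford b X)
    (j : nat) (hj : (2 <= j)%N) (a : nat) (ha : (a < b)%N) :
  P [set w | msdigit b j (X w) = a%:Z] =
  (log_base b
     ((Gamma ((a + 1)%:R * b%:R^-1 + b%:R ^+ (j - 1)) *
       Gamma (a%:R * b%:R^-1 + b%:R ^+ (j - 2))) /
      (Gamma ((a + 1)%:R * b%:R^-1 + b%:R ^+ (j - 2)) *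
       Gamma (a%:R * b%:R^-1 + b%:R ^+ (j - 1)))))%:E.
Proof.
case: hX => _ _ unif.
case: j hj => [//|[//|j]] _; rewrite subn1 subn2 /=.
have b0 : 0 < b%:R :> R by rewrite ltr0n; lia.
have lb := @natr_ln_gt0 R b hb.
have bj : (0 < b ^ j)%N by rewrite expn_gt0; lia.
pose n := (b ^ j.+1 - b ^ j)%N.
have nE : (b ^ j + n = b ^ j.+1)%N by rewrite subnKC// leq_exp2l.
pose s i := ((b ^ j + i) * b + a)%N.
have s0 i : (0 < s i)%N by rewrite /s; nia.
have sinj : injective s by move=> i k; rewrite /s; nia.
pose U : set R := \big[setU/set0]_(i < n) significand_itv b j.+2 (s i).
have mI i : measurable (significand_itv b j.+2 (s i) : set R).
  exact: measurable_itv.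
have mU : measurable U by apply: bigsetU_measurable.
have -> : [set w | msdigit b j.+2 (X w) = a%:Z] =
    [set w | U (fracpart (log_base b (X w)))].
  apply/funext => w /=; apply/propext; rewrite msdigitP// /U
    -(bigcup_mkord n (fun i => significand_itv b j.+2 (s i))).
  split=> [[k /andP[k1 k2] hk]|[i /= ilt hi]].
  - exists (k - b ^ j)%N; rewrite /= /s ?subnKC// /n; lia.
  - by exists (b ^ j + i)%N => //; lia.
rewrite unif//.
have -> : uniform_prob (@ltr01 R) U =
    (\sum_(i < n) uniform_prob (@ltr01 R) (significand_itv b j.+2 (s i)))%E.
  apply: (@measure_semi_additive_ord_I _ _ R (uniform_prob (@ltr01 R))
    (fun i => significand_itv b j.+2 (s i)) n) => //.
    by move=> k _; exact: mI.
  exact: trivIset_significand_itv.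
have logX (k : nat) : log_base b ((b ^ k)%:R : R) = k%:R.
  by rewrite /log_base natrX lnXn// -[ln _ *+ _]mulr_natl mulfK// gt_eqF.
have log_le (m m' : nat) : (0 < m)%N -> (m <= m')%N ->
    log_base b (m%:R : R) <= log_base b m'%:R.
  move=> m0 mm; rewrite /log_base ler_pM2r ?invr_gt0// ler_ln ?posrE ?ltr0n ?ler_nat//.
  exact: leq_trans mm.
under eq_bigr => i _.
  rewrite /significand_itv uniform_prob_itv; last first.
  (* The interval does not reach beyond 1 since s i + 1 <= b^(j+2). *)
  - have : log_base b ((s i).+1%:R : R) <= log_base b (b ^ j.+2)%N%:R.
      by apply: log_le => //; rewrite /s expnSr -nE; have := ltn_ord i; nia.
    by rewrite logX -[j.+2%:R]natr1; lra.
  - by have := log_le (s i) (s i).+1 (s0 i) (leqnSn _); lra.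
  (* The interval does not start before 0 since s i >= b^(j+1). *)
  - have : log_base b (b ^ j.+1)%N%:R <= log_base b (s i)%:R :> R.
      by apply: log_le; rewrite ?expn_gt0 /s ?expnSr; nia.
    by rewrite logX -[j.+2%:R]natr1; lra.
  over.
rewrite sumEFin; congr EFin.
have ge1 (c : nat) : 1 <= c%:R * b%:R^-1 + b%:R ^+ j :> R.
  by rewrite -natrX ler_wpDl ?mulr_ge0// ?invr_ge0 ?ler0n// ler1n.
(* The terms are rescaled by b to match the significands (b^j + i) b + c. *)
have shift (c : nat) : ln (Gamma (c%:R * b%:R^-1 + b%:R ^+ j.+1)) -
    ln (Gamma (c%:R * b%:R^-1 + b%:R ^+ j)) =
    \sum_(i < n) (ln (c%:R + (b ^ j + i)%:R * b%:R) - ln b%:R) :> R.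
  rewrite -!natrX -nE natrD addrA ln_Gamma_add_nat ?natrX//.
  rewrite addrAC subrr add0r; apply: eq_bigr => i _.
  rewrite -natrX -addrA -natrD -ln_div ?posrE//; last first.
    by rewrite ltr_wpDl// mulr_gt0// ltr0n; lia.
  by rewrite mulrDl mulfK// gt_eqF.
have G0 (c : nat) : 0 < Gamma (c%:R * b%:R^-1 + b%:R ^+ j) :> R by exact: Gamma_gt0.
have G1 (c : nat) : 0 < Gamma (c%:R * b%:R^-1 + b%:R ^+ j.+1) :> R.
  apply: Gamma_gt0; apply: (le_trans (ge1 c)).
  by rewrite lerD2l ler_eXn2l ?ltr1n.
rewrite log_base_cross_ratio; [|exact: G1|exact: G0|exact: G0|exact: G1].
rewrite (shift (a + 1)%N) (shift a).
rewrite -sumrB mulr_suml; apply: eq_bigr => i _.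
have -> : (s i).+1%:R = (a + 1)%:R + (b ^ j + i)%:R * b%:R :> R.
  by rewrite -natrM -natrD; congr _%:R; rewrite /s; lia.
have -> : (s i)%:R = a%:R + (b ^ j + i)%:R * b%:R :> R.
  by rewrite -natrM -natrD; congr _%:R; rewrite /s; lia.
by rewrite /log_base; field; rewrite gt_eqF.
Qed.
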